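(* Let $n\ge2$, let $\mathbf p=(p_1,\dots,p_n)$ be a probability vector with $0<p_1\le\dots\le p_n$, let $\eta\in\mathbb R$, let $\boldsymbol\delta^{**}$ be the Dirichlet mixture defined in the context, and let $S(\mathbf p,\boldsymbol\delta)=\gamma(\boldsymbol\delta-\mathbf p)$ with $\gamma=\frac{n^{\eta+1}+1}{np_1^2}$. Then $\boldsymbol\delta=\boldsymbol\delta^{**}$ satisfies (MC1) $E[S(\mathbf p,\boldsymbol\delta)]=\mathbf 0$, and (MC2) $E[(\boldsymbol\delta-\mathbf p)S(\mathbf p,\boldsymbol\delta)']=\mathbf I-\lambda\mathbf 1\mathbf 1'$ for some $\lambda\in\mathbb R$. In addition, for $Z:\mathcal P\to\mathbb R$ of class $\mathcal C^2$ and $c>0$, there exists $\epsilon_0\in\mathbb R$ such that $$\Big\|\frac c2E\big[(\boldsymbol\delta-\mathbf p)'\nabla^2Z(\mathbf p)(\boldsymbol\delta-\mathbf p)\,S(\mathbf p,\boldsymbol\delta)\big]-\epsilon_0\mathbf 1\Big\|_\infty=O\big(c\,\|\nabla^2Z\|_\infty\,n^{-\eta-1}\big).$$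
   Context: $\mathcal P=\{\mathbf p\in\mathbb R^n:\sum_ip_i=1,\ p_i\ge0\}$; $\mathbf 1$ is the all-ones vector, $\mathbf I$ the identity matrix, $\mathbf e_i$ the $i$-th standard basis vector, $'$ denotes transpose. $\|\cdot\|_\infty$ is the entrywise maximum of absolute values of a vector or matrix; $\|\nabla^2Z\|_\infty$ is the entrywise maximum of the Hessian $\nabla^2Z(\mathbf p)$. Derivatives on the simplex. $F:\mathcal P\to\mathbb R$ is differentiable at $\mathbf p$ if there is a vector $\nabla F(\mathbf p)$ with $F(\mathbf q)-F(\mathbf p)=\nabla F(\mathbf p)'(\mathbf q-\mathbf p)+o(\|\mathbf q-\mathbf p\|)$ for $\mathbf q\in\mathcal P$, and $\nabla F(\mathbf p)=(F_1(\mathbf p),\dots,F_n(\mathbf p))'$ denotes the version $F_i(\mathbf p)=\lim_{\epsilon\to0_+}\frac{F((1-\epsilon)\mathbf p+\epsilon\mathbf e_i)-F(\mathbf p)}{\epsilon}$. Higher derivatives are defined recursively by $F_{i,j}=(F_i)_j$, and $\nabla^2F(\mathbf p)=(F_{i,j}(\mathbf p))_{i,j}$. $\mathcal C^2$ means derivatives up to order 2 exist in this sense and are continuous. Construction of $\boldsymbol\delta^{**}$: $\boldsymbol\delta^{**}=\sum_{l=1}^n\theta^l\boldsymbol\delta^l$ with $\theta^1=np_1$, $\theta^l=p_l-p_1$ for $l=2,\dots,n$; the $\boldsymbol\delta^l$ are mutually independent, $\boldsymbol\delta^1$ is Dirichlet with parameter vector $n^\eta\mathbf 1$, and for $l\ge2$,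 $\boldsymbol\delta^l\sim Dir(\mathbf e_l)$, i.e. $\boldsymbol\delta^l=\mathbf e_l$ (coordinates with zero Dirichlet parameter are set to $0$). $O(X)$ means bounded by an absolute constant times $X$ (independent of $n,\mathbf p,\eta,c,Z$). *)

(* Defs.v *)
From mathcomp Require Export all_boot all_order all_algebra.
From mathcomp Require Export all_classical all_reals all_analysis.
From mathcomp Require Export measurable_realfun.
Export Order.TTheory GRing.Theory Num.Theory.
Export numFieldNormedType.Exports.

Set Implicit Arguments.
Unset Strict Implicit.
Unset Printing Implicit Defensive.

Local Open Scope classical_set_scope.
Local Open Scope ring_scope.

(* Vectors of R^n are columns 'cV[R]_n, and `|M| on matrices is the entrywise
   maximum of absolute values. Random vectors take values in n.-tuple R, which
   carries the Borel (product) sigma-algebra of R^n; matrices carry none. *)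

Definition simplex (R : realType) (n : nat) : set 'cV[R]_n :=
  [set p | (forall i, 0 <= p i 0) /\ \sum_i p i 0 = 1].

Section Derivatives.
Context {R : realType} {n : nat}.

(* A function on the simplex is a total function F of which only the values on
   the simplex matter: for p in the simplex, (1 - e) p + e e_i is in the
   simplex as soon as 0 <= e <= 1. *)
Definition partial (F : 'cV[R]_n -> R) (i : 'I_n) (p : 'cV[R]_n) : R :=
  lim ((F ((1 - e) *: p + e *: delta_mx i 0) - F p) / e @[e --> 0^'+]).

Definition differentiable_simplex (F : 'cV[R]_n -> R) (p : 'cV[R]_n) : Prop :=
  exists g : 'cV[R]_n, forall eps : R, 0 < eps ->
    \forall q \near within (@simplex R n) (nbhs p),
      `|F q - F p - (g^T *m (q - p)) 0 0| <= eps * `|q - p|.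

Fixpoint class_C (k : nat) (F : 'cV[R]_n -> R) : Prop :=
  {within @simplex R n, continuous F} /\
  if k is k'.+1 then
    (forall p, simplex p -> differentiable_simplex F p) /\
    (forall i, class_C k' (partial F i))
  else True.

Definition hessian (F : 'cV[R]_n -> R) (p : 'cV[R]_n) : 'M[R]_n :=
  \matrix_(i, j) partial (partial F i) j p.

End Derivatives.

Section Dirichlet.
Context {R : realType} {n : nat}.

(* Iterated Lebesgue integral of f over the coordinates listed in s (Lebesgue
   measure on R^s, by Tonelli, for f >= 0), the others being those of x. *)
Fixpoint iterated_integral (s : seq 'I_n) (f : 'cV[R]_n -> \bar R)
    (x : 'cV[R]_n) : \bar R :=
  if s is i :: s' then
    (\int[lebesgue_measure]_t
       iterated_integral s' f (x + (t : R) *: delta_mx i 0)%R)%E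
  else f x.

Definition dirichlet_kernel (a x : 'cV[R]_n) : R :=
  if [forall i, (0 < a i 0) ==> (0 < x i 0)]
  then \prod_(i | 0 < a i 0) x i 0 `^ (a i 0 - 1) else 0.

(* Integral of f against the unnormalized Dirichlet density on the open face of
   the simplex spanned by the support {k} + s of a. The chart of the face is
   given by the coordinates in s, with x_k = 1 - sum_(i in s) x_i, and the
   coordinates outside the support are 0. *)
Definition dirichlet_integral (a : 'cV[R]_n) (f : n.-tuple R -> \bar R) :
    \bar R :=
  if [seq i <- enum 'I_n | 0 < a i 0] is k :: s then
    iterated_integral s (fun y =>
      let x : 'cV[R]_n := (y + (1 - \sum_i y i 0) *: delta_mx k 0)%R in
      (f [tuple x i 0%R | i < n] * (dirichlet_kernel a x)%:E)%E) 0%R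
  else 0%E.

(* X ~ Dir(a), for a parameter vector a >= 0, a <> 0: the nonzero-parameter
   coordinates have the Dirichlet density, the others are 0. The normalizing
   constant is the multivariate beta function
   B(a) = dirichlet_integral a (cst 1). *)
Definition is_dirichlet {d} {T : measurableType d} (P : probability T R)
    (X : {RV P >-> n.-tuple R}) (a : 'cV[R]_n) : Prop :=
  [/\ forall i, 0 <= a i 0,
      exists i, 0 < a i 0 &
      forall f : n.-tuple R -> \bar R,
        measurable_fun [set: n.-tuple R] f -> (forall x, (0 <= f x)%E) ->
        (\int[P]_w f (X w) =
         ((fine (dirichlet_integral a (cst 1%E)))^-1)%:E *
         dirichlet_integral a f)%E].

End Dirichlet.

Definition mutually_independent {d d'} {T : measurableType d}
    {E : measurableType d'} {R : realType} (P : probability T R) (I : finType)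
    (X : I -> {RV P >-> E}) : Prop :=
  forall (J : {set I}) (A : I -> set E),
    (forall l, l \in J -> measurable (A l)) ->
    P (\bigcap_(l in [set` J]) (X l @^-1` A l)) =
    (\prod_(l in J) P (X l @^-1` A l))%E.

(* 'E_P has values in \bar R; `fine' returns the real value of a finite
   expectation, which is all that bounded random matrices need. *)
Definition expectation_mx {d} {T : measurableType d} {R : realType}
    (P : probability T R) (m n : nat) (X : T -> 'M[R]_(m, n)) : 'M[R]_(m, n) :=
  \matrix_(i, j) fine 'E_P[fun w => X w i j].

Section Mixture.
Context {R : realType} {n : nat}.

(* i1 stands for the first index of 'I_n, numbered 0. *)
Definition theta (i1 : 'I_n) (p : 'cV[R]_n) (l : 'I_n) : R :=
  if l == i1 then n%:R * p i1 0 else p l 0 - p i1 0.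

Definition mixture {T : Type} (i1 : 'I_n) (p : 'cV[R]_n)
    (delta : 'I_n -> T -> n.-tuple R) (w : T) : 'cV[R]_n :=
  \sum_l theta i1 p l *: \col_i tnth (delta l w) i.

Definition gamma_coef (i1 : 'I_n) (p : 'cV[R]_n) (eta : R) : R :=
  (n%:R `^ (eta + 1) + 1) / (n%:R * p i1 0 ^+ 2).

End Mixture.

(* Main.v *)
(* For a symmetric Dirichlet vector X with parameter alpha and n coordinates,
   delta** - p = n p_1 (X - 1/n) almost surely, so only the moments of X matter.
   Beta integrals satisfy B(a+1,c) = a/(a+c) B(a,c); iterating over the chart of
   the simplex, the Dirichlet integral with exponents b acquires the factor
   b_j / sum b when b_j is increased by 1, which gives all monomial moments. With
   A = n alpha = n^(eta+1), the centered moments of order 2 and 3 are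
     (n [i=j] - 1) / (n^2 (A+1)),
     (2 n^2 [i=j=k] - 2 n ([i=j] + [i=k] + [j=k]) + 4) / (n^3 (A+1) (A+2)).
   The first is (MC2); summing the second against the Hessian H leaves, up to a
   term independent of k, 2 (n^2 H_kk - n sum_i (H_ki + H_ik)), bounded by
   6 n^2 |H|, and the prefactors (with n p_1 <= 1) give the constant C = 3. *)
Require Import Defs.
From HB Require Import structures.
From mathcomp Require Import ring lra.

Set Implicit Arguments.
Unset Strict Implicit.
Unset Printing Implicit Defensive.

Local Open Scope classical_set_scope.
Local Open Scope ring_scope.

(** * Truncated powers and their homogeneity *)

Section truncated_power.
Context {R : realType}.
Implicit Types a b c r t x : R.

(* Vanishing for [x <= 0] lets integrals over simplices be written over all of R. *)
Definition tpow b x : R := if 0 < x then x `^ (b - 1) else 0.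

Lemma tpow_ge0 b x : 0 <= tpow b x.
Proof. by rewrite /tpow; case: ifP => // _; exact: powR_ge0. Qed.

Lemma tpow1 b : tpow b 1 = 1.
Proof. by rewrite /tpow ltr01 powR1. Qed.

Lemma tpow_le0 b x : x <= 0 -> tpow b x = 0.
Proof. by rewrite /tpow leNgt => /negbTE ->. Qed.

Lemma tpowS b x : tpow (b + 1) x = x * tpow b x.
Proof.
rewrite /tpow; case: ifPn => [x0|_]; last by rewrite mulr0.
rewrite (_ : b + 1 - 1 = 1 + (b - 1)); last by ring.
by rewrite (@powRD _ x 1) ?(gt_eqF x0) ?implybT// powRr1// ltW.
Qed.

Lemma tpowM b r t : 0 < r -> tpow b (r * t) = r `^ (b - 1) * tpow b t.
Proof.
move=> r0; rewrite /tpow pmulr_rgt0//; case: ifPn => [t0|_]; last by rewrite mulr0.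
by rewrite powRM ?ltW.
Qed.

Lemma measurable_tpow b : measurable_fun [set: R] (tpow b).
Proof.
apply: measurable_fun_ifT => //.
exact: measurable_fun_ltr.
Qed.

End truncated_power.

(** * Change of variables under a dilation of the line *)

Section lebesgue_scaling.
Local Open Scope ereal_scope.
Context {R : realType}.
Notation mu := (@lebesgue_measure R).

(** By uniqueness of Lebesgue measure: the image of [mu] under multiplication by [r], rescaled by
    [r], gives each interval []a, b]] its length, hence equals [mu]. *)
Lemma ge0_integral_scale (r : R) (f : R -> \bar R) : (0 < r)%R ->
  measurable_fun [set: R] f -> (forall x, 0 <= f x) ->
  \int[mu]_x f x = r%:E * \int[mu]_x f (r * x)%R.
Proof.
move=> r0 mf f0; pose h : R -> measurableTypeR R := *%R r.
have mh : measurable_fun [set: R] h by exact: mulrl_measurable.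
have [nu nuE] : exists nu : measure (measurableTypeR R) R,
    nu = pushforward mu h :> (set _ -> \bar R).
  by unshelve refine (ex_intro _ (pushforward mu h : measure _ _) _).
have scaleE (A : set R) : measurable A -> mscale (NngNum (ltW r0)) nu A = mu A.
  move=> mA; apply/esym/lebesgue_measure_unique => // _ [[a b]] _ <-.
  rewrite /= /mscale/= [Measure.sort nu]nuE /pushforward.
  rewrite (_ : _ @^-1` _ = `](a / r)%R, (b / r)%R]%classic); last first.
    apply/seteqP; split => x /=; rewrite /h !in_itv/= ltr_pdivrMr// ler_pdivlMr//;
      by rewrite (mulrC r).
  rewrite !lebesgue_measure_itv/= !lte_fin ltr_pM2r ?invr_gt0//.
  case: ifP => _; last by rewrite mule0.
  by rewrite -!EFinB -EFinM -mulrBl mulrC divfK ?gt_eqF.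
transitivity (\int[mscale (NngNum (ltW r0)) nu]_x f x).
  by apply: eq_measure_integral => A mA _; exact/esym/scaleE.
rewrite ge0_integral_mscale// nuE; congr (_ * _).
by rewrite ge0_integral_pushforward.
Qed.

End lebesgue_scaling.

(** * Beta integrals and convolutions of truncated powers *)

HB.lock Definition beta_integral (R : realType) (a c : R) : \bar R :=
  (\int[lebesgue_measure]_t (tpow a t * tpow c (1 - t))%:E)%E.

Section beta_integral.
Context {R : realType}.
Implicit Types a b c r t x : R.
Local Open Scope ereal_scope.
Notation mu := (@lebesgue_measure R).

Lemma beta_integral_ge0 a c : 0 <= beta_integral a c.
Proof.
by rewrite unlock; apply: integral_ge0 => t _; rewrite lee_fin mulr_ge0// tpow_ge0.
Qed.

Lemma measurable_tpow_conv a c r :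
  measurable_fun [set: R] (fun t => (tpow a t * tpow c (r - t))%:E).
Proof.
apply/measurable_EFinP; apply: measurable_funM; first exact: measurable_tpow.
apply: measurableT_comp; first exact: measurable_tpow.
exact: measurable_funB.
Qed.

(** For [r > 0], substitute [r * t] for [t]: homogeneity extracts [r] to the power
    [(a - 1) + (c - 1) + 1]. For [r <= 0] the supports of the two factors are disjoint. This is the
    one-variable step of every simplex integral below. *)
Lemma integral_tpow_conv a c r :
  \int[mu]_t (tpow a t * tpow c (r - t))%:E =
  beta_integral a c * (tpow (a + c) r)%:E.
Proof.
have [r0|r0] := leP r 0%R.
  rewrite (tpow_le0 _ r0) mule0 integral0_eq// => t _.
  have [t0|t0] := leP t 0%R; first by rewrite tpow_le0// mul0r.
  by rewrite (tpow_le0 _ (_ : r - t <= 0)%R) ?mulr0//; lra.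
rewrite (ge0_integral_scale r0); first last.
- by move=> t; rewrite lee_fin mulr_ge0// tpow_ge0.
- exact: measurable_tpow_conv.
under eq_integral.
  move=> t _.
  rewrite (_ : r - r * t = r * (1 - t))%R; last by ring.
  rewrite !tpowM// mulrACA EFinM.
  over.
rewrite ge0_integralZl//; first last.
- by rewrite lee_fin mulr_ge0// powR_ge0.
- by move=> t _; rewrite lee_fin mulr_ge0// tpow_ge0.
- exact: measurable_tpow_conv.
rewrite unlock muleA muleC -EFinM; congr (_ * _%:E).
rewrite /tpow r0 -powRD ?(gt_eqF r0) ?implybT//.
rewrite -{1}(powRr1 (ltW r0)) -powRD ?(gt_eqF r0) ?implybT//.
by congr (_ `^ _)%R; ring.
Qed.

(** Insert [1 = t + (1 - t)] under the integral. *)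
Lemma beta_integral_split a c :
  beta_integral a c = beta_integral (a + 1) c + beta_integral a (c + 1).
Proof.
rewrite unlock -ge0_integralD//; first last.
- exact: measurable_tpow_conv.
- by move=> t _; rewrite lee_fin mulr_ge0// tpow_ge0.
- exact: measurable_tpow_conv.
- by move=> t _; rewrite lee_fin mulr_ge0// tpow_ge0.
by apply: eq_integral => t _; rewrite -EFinD !tpowS; congr (_%:E); ring.
Qed.

End beta_integral.

(** * Recurrences of the beta integral, by integration by parts *)

Section beta_recurrence.
Context {R : realType}.
Implicit Types a c e t : R.
Notation mu := (@lebesgue_measure R).

Lemma is_derive_powR_onem c t : t < 1 ->
  is_derive t 1 (fun x : R => (1 - x) `^ c) (- (c * (1 - t) `^ (c - 1))).
Proof.
move=> t1.
have t1' : 0 < 1 - t by rewrite subr_gt0.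
have := is_derive1_powR c t1'; move=> dp.
have d1 : is_derive t 1 (fun x => 1 - x) (-1).
  by apply: is_derive_eq; rewrite add0r mul1r.
have := is_derive1_comp (g := fun x => 1 - x) dp d1.
by rewrite mulrN1.
Qed.

Lemma derivable_LRcontinuous (f : R -> R) (x y : R) :
  {in `[x, y], forall z, derivable f z 1} -> x <= y ->
  derivable_oo_LRcontinuous f x y.
Proof.
move=> df xy.
have cf z : z \in `[x, y] -> {for z, continuous f}.
  by move=> /df /derivable1_diffP /differentiable_continuous.
split.
- by move=> z zxy; apply: df; exact: subset_itv_oo_cc zxy.
- by apply: cvg_at_right_filter; apply: cf; rewrite in_itv/= lexx.
- by apply: cvg_at_left_filter; apply: cf; rewrite in_itv/= lexx andbT.
Qed.

(** Integration by parts with [(1 - t)]^ c[and]t [^ a]. Staying away from 0 and 1 keeps both powers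
    differentiable on the closed interval, whatever the exponents; the boundary term is kept for a
    later limit. *)
Lemma beta_by_parts_itv a c e : 0 < e -> e < 1 - e -> 0 < c ->
  (\int[mu]_(t in `[e, (1 - e)%R]) (a * (tpow a t * tpow (c + 1) (1 - t)))%:E =
   \int[mu]_(t in `[e, (1 - e)%R]) (c * (tpow (a + 1) t * tpow c (1 - t)))%:E +
   ((1 - e) `^ a * e `^ c - e `^ a * (1 - e) `^ c)%:E)%E.
Proof.
move=> e0 e1 c0.
have itvP t : t \in `[e, 1 - e] -> (0 < t) * (t < 1).
  by rewrite in_itv/= => /andP[? ?]; split; lra.
have dG (b t : R) : t \in `[e, 1 - e] -> derivable (@powR R ^~ b) t 1.
  by move=> /itvP[t0 t1]; have := is_derive1_powR b t0 => -[].
have dF (b t : R) : t \in `[e, 1 - e] -> derivable (fun x : R => (1 - x) `^ b) t 1.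
  by move=> /itvP[t0 t1]; have := is_derive_powR_onem b t1 => -[].
transitivity (\int[mu]_(t in `[e, (1 - e)%R])
    ((1 - t) `^ c * (a * t `^ (a - 1)))%:E)%E.
  apply: eq_integral => t; rewrite inE/= => /itvP[t0 t1].
  rewrite /tpow t0 subr_gt0 t1; congr (_%:E).
  by rewrite addrK; ring.
rewrite (@integration_by_parts _ _ (@powR R ^~ a)
  (fun t => - (c * (1 - t) `^ (c - 1))) _ _ _ e1); first last.
- move=> t /subset_itv_oo_cc /itvP[t0 t1].
  by apply: powR_derive1; rewrite in_itv/= t0.
- by apply: derivable_LRcontinuous; [exact: dG|exact: ltW].
- apply: derivable_within_continuous => t tI.
  by apply: derivableM => //; exact: dG.
- move=> t /subset_itv_oo_cc /itvP[t0 t1].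
  by rewrite derive1E; have [_ ->] := is_derive_powR_onem c t1.
- by apply: derivable_LRcontinuous; [exact: dF|exact: ltW].
- apply: derivable_within_continuous => t tI.
  by apply: derivableN; apply: derivableM => //; exact: dF.
rewrite [RHS]addeC; congr (_ + _)%E; first by rewrite subKr; congr (_%:E); ring.
rewrite -[RHS]oppeK -[X in _ = (- X)%E]integral_ge0N; last first.
  by move=> t /= _; rewrite lee_fin !mulr_ge0 ?tpow_ge0// ltW.
congr (- _)%E.
apply: eq_integral => t; rewrite inE/= => /itvP[t0 t1].
rewrite /tpow t0 subr_gt0 t1 addrK /=; congr (_%:E).
by ring.
Qed.

(** An increasing exhaustion of []0, 1[]. Dividing by 3 makes the interval nondegenerate already at
    [n = 0], where [harmonic n] is 1. *)
Let trunc (n : nat) : set R := `[harmonic n / 3, 1 - harmonic n / 3].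

Let trunc_gt0 n : 0 < harmonic n / 3 :> R.
Proof. by rewrite divr_gt0// invr_gt0 ltr0n. Qed.

Let trunc_lt1 n : harmonic n / 3 < 1 - harmonic n / 3 :> R.
Proof.
have : harmonic n <= 1 :> R by rewrite invf_le1 ?ler1n ?ltr0n.
lra.
Qed.

Let cvg_trunc : harmonic n / 3 @[n --> \oo] --> (0 : R).
Proof.
by rewrite -[X in _ --> X](mul0r 3^-1); apply: cvgMl; exact: cvg_harmonic.
Qed.

Let bigcup_trunc : \bigcup_n trunc n = `]0, 1[%classic.
Proof.
apply/seteqP; split => t /=.
  move=> [n _]; have := trunc_gt0 n; rewrite /trunc /harmonic /= !in_itv/=.
  by move: (_ / 3) => h h0 /andP[nt tn]; apply/andP; split; lra.
rewrite in_itv/= => /andP[t0 t1].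
have : \forall n \near \oo, harmonic n / 3 < Num.min t (1 - t) :> R.
  by apply: (cvgr_lt (0 : R)) => //; rewrite lt_min t0 subr_gt0.
move=> [N _ /(_ N (leqnn N))] /=; move=> h; exists N => //; move: h.
rewrite /trunc /harmonic /= in_itv/= lt_min; move: (_ / 3) => h.
by move=> /andP[h1 h2]; apply/andP; split; lra.
Qed.

(** Monotone convergence along the exhaustion, whose union carries all of [f]. *)
Lemma cvg_integral_trunc (f : R -> \bar R) :
  measurable_fun [set: R] f -> (forall t, 0 <= f t)%E ->
  (forall t, ~~ (0 < t < 1) -> f t = 0%E) ->
  (\int[mu]_(t in trunc n) f t)%E @[n --> \oo] --> (\int[mu]_t f t)%E.
Proof.
move=> mf f0 fout.
have -> : (\int[mu]_t f t = \int[mu]_(t in \bigcup_n trunc n) f t)%E.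
  rewrite bigcup_trunc [RHS]integral_mkcond; apply: eq_integral => t _.
  rewrite patchE; case: ifPn => //; rewrite notin_setE/= in_itv/= => /negP.
  exact: fout.
apply: ge0_nondecreasing_set_cvg_integral => //.
- move=> m n mn; apply/subsetPset => t; rewrite /trunc/= !in_itv/=.
  have : n.+1%:R^-1 <= m.+1%:R^-1 :> R.
    by rewrite lef_pV2 ?posrE ?ltr0n// ler_nat.
  move: (n.+1%:R^-1) (m.+1%:R^-1) => h h' hh' /andP[h1 h2].
  by apply/andP; split; lra.
- by move=> n; exact: measurable_itv.
- by move=> n; exact: measurable_funTS.
Qed.

(** Each product has a factor in [[0, 1]] and a factor tending to 0, since its exponent is
    positive. *)
Let cvg_boundary a c : 0 < a -> 0 < c ->
  ((1 - harmonic n / 3) `^ a * (harmonic n / 3) `^ c -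
   (harmonic n / 3) `^ a * (1 - harmonic n / 3) `^ c : R) @[n --> \oo] --> (0 : R).
Proof.
move=> a0 c0.
have p0 b : 0 < b -> ((harmonic n / 3) `^ b : R) @[n --> \oo] --> (0 : R).
  move=> b0; apply: ((cvg_at_rightP _ _ _).1 (powR_cvg0 b0)).
  by split; [exact: trunc_gt0|exact: cvg_trunc].
have p1 (b : R) n : 0 < b -> 0 <= ((1 - harmonic n / 3) `^ b : R) <= 1.
  move=> b0; rewrite powR_ge0/=.
  suff: (1 - harmonic n / 3) `^ b <= 1 `^ b :> R by rewrite powR1.
  apply: ge0_ler_powR; rewrite ?ltW//.
  - by rewrite nnegrE; have := trunc_gt0 n; have := trunc_lt1 n; lra.
  - by rewrite nnegrE.
  - by have := trunc_gt0 n; lra.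
rewrite -[X in _ --> X](subr0 0); apply: cvgB.
- apply: (squeeze_cvgr _ (cvg_cst 0) (p0 c c0)); apply: nearW => n.
  have /andP[h0 h1] := p1 a n a0.
  by rewrite mulr_ge0 ?powR_ge0//= ler_piMl ?powR_ge0.
- apply: (squeeze_cvgr _ (cvg_cst 0) (p0 a a0)); apply: nearW => n.
  have /andP[h0 h1] := p1 c n c0.
  by rewrite mulr_ge0 ?powR_ge0//= ler_piMr ?powR_ge0.
Qed.

(** The truncated integrals of the left side tend to both sides of the equation: directly, and
    through integration by parts with a vanishing boundary term. Limits in [\bar R] are unique. *)
Lemma beta_by_parts a c : 0 < a -> 0 < c ->
  (a%:E * beta_integral a (c + 1) = c%:E * beta_integral (a + 1) c)%E.
Proof.
move=> a0 c0.
have out (b b' t : R) : ~~ (0 < t < 1) -> tpow b t * tpow b' (1 - t) = 0.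
  rewrite negb_and -!leNgt => /orP[t0|t1]; first by rewrite tpow_le0 ?mul0r.
  by rewrite (tpow_le0 _ (_ : 1 - t <= 0)) ?mulr0// subr_le0.
have lhs : (\int[mu]_(t in trunc n)
    (a * (tpow a t * tpow (c + 1) (1 - t)))%:E)%E @[n --> \oo] -->
    (a%:E * beta_integral a (c + 1))%E.
  rewrite unlock -ge0_integralZl//; first last.
  - by rewrite lee_fin ltW.
  - by move=> t _; rewrite lee_fin mulr_ge0// tpow_ge0.
  - exact: measurable_tpow_conv.
  apply: cvg_integral_trunc.
  - apply/measurable_EFinP; apply: measurable_funM => //.
    by apply/measurable_EFinP; exact: measurable_tpow_conv.
  - by move=> t; rewrite lee_fin !mulr_ge0 ?tpow_ge0// ltW.
  - by move=> t /out ->; rewrite mulr0.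
have rhs : (\int[mu]_(t in trunc n)
    (c * (tpow (a + 1) t * tpow c (1 - t)))%:E)%E @[n --> \oo] -->
    (c%:E * beta_integral (a + 1) c)%E.
  rewrite unlock -ge0_integralZl//; first last.
  - by rewrite lee_fin ltW.
  - by move=> t _; rewrite lee_fin mulr_ge0// tpow_ge0.
  - exact: measurable_tpow_conv.
  apply: cvg_integral_trunc.
  - apply/measurable_EFinP; apply: measurable_funM => //.
    by apply/measurable_EFinP; exact: measurable_tpow_conv.
  - by move=> t; rewrite lee_fin !mulr_ge0 ?tpow_ge0// ltW.
  - by move=> t /out ->; rewrite mulr0.
have parts n := beta_by_parts_itv a (trunc_gt0 n) (trunc_lt1 n) c0.
have bdry : ((1 - harmonic n / 3) `^ a * (harmonic n / 3) `^ c -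
    (harmonic n / 3) `^ a * (1 - harmonic n / 3) `^ c)%:E @[n --> \oo] --> (0 : \bar R)%E.
  by apply: cvg_EFin; [exact: nearW|exact: cvg_boundary].
have lhs' : (\int[mu]_(t in trunc n)
    (a * (tpow a t * tpow (c + 1) (1 - t)))%:E)%E @[n --> \oo] -->
    (c%:E * beta_integral (a + 1) c)%E.
  rewrite -[X in _ --> X]adde0 (funext parts : (fun n => _) = _).
  (* The sum of the limits is well defined because the boundary limit is finite. *)
  by apply: cvgeD => //; rewrite fin_num_adde_defl.
by rewrite -(cvg_lim (@ereal_hausdorff R) lhs) (cvg_lim (@ereal_hausdorff R) lhs').
Qed.

(** With [x = B(a+1,c)] and [y = B(a,c+1)], the splitting gives [B(a,c) = x + y] and integration by
    parts gives [a y = c x], so [(a + c) x = a x + a y]. Nonnegativity justifies distributing in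
    [\bar R]. *)
Lemma beta_integral_incl a c : 0 < a -> 0 < c ->
  ((a + c)%:E * beta_integral (a + 1) c = a%:E * beta_integral a c)%E.
Proof.
move=> a0 c0; rewrite (beta_integral_split a c).
have := beta_by_parts a0 c0.
move: (beta_integral_ge0 (a + 1) c) (beta_integral_ge0 a (c + 1)).
move: (beta_integral (a + 1) c) (beta_integral a (c + 1)) => x y x0 y0 xy.
by rewrite ge0_muleDr// xy EFinD ge0_muleDl ?lee_fin ?ltW.
Qed.

Lemma beta_integral_incr a c : 0 < a -> 0 < c ->
  ((a + c)%:E * beta_integral a (c + 1) = c%:E * beta_integral a c)%E.
Proof.
move=> a0 c0; rewrite (beta_integral_split a c).
have := beta_by_parts a0 c0.
move: (beta_integral_ge0 (a + 1) c) (beta_integral_ge0 a (c + 1)).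
move: (beta_integral (a + 1) c) (beta_integral a (c + 1)) => x y x0 y0 xy.
by rewrite ge0_muleDr// -xy EFinD ge0_muleDl ?lee_fin ?ltW.
Qed.

End beta_recurrence.

(** * Dirichlet integrals as products of beta integrals *)

Section dirichlet_integral.
Context {R : realType} {n : nat}.
Implicit Types (k i j : 'I_n) (s l : seq 'I_n) (b : 'I_n -> R) (y : 'cV[R]_n).
Notation mu := (@lebesgue_measure R).

(** The multivariate beta function of the parameters on [k :: s], factored along the chart. The
    second beta argument gathers the parameters of [k] and of the coordinates integrated before
    [i]. *)
Fixpoint dirichlet_const k s b : \bar R :=
  if s is i :: s' then
    (dirichlet_const k s' b * beta_integral (b i) (b k + \sum_(j <- s') b j)%R)%E
  else 1%E.

Lemma dirichlet_const_ge0 k s b : (0 <= dirichlet_const k s b)%E.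
Proof.
by elim: s => //= i s IH; rewrite mule_ge0// beta_integral_ge0.
Qed.

Lemma eq_dirichlet_const k s b b' : {in k :: s, b =1 b'} ->
  dirichlet_const k s b = dirichlet_const k s b'.
Proof.
elim: s => //= i s IH bb'.
rewrite IH; last first.
  by move=> j; rewrite inE => /predU1P[->|js]; apply: bb'; rewrite !inE ?eqxx ?js ?orbT.
rewrite bb' ?inE ?eqxx ?orbT// bb' ?inE ?eqxx//; congr (_ * beta_integral _ (_ + _)%R)%E.
by apply: eq_big_seq => j js; apply: bb'; rewrite !inE js !orbT.
Qed.

(** The recurrence behind all moments: raising parameter [j] by 1 multiplies the constant by [b j]
    over the total. It is stated without division so that it makes sense in [\bar R]. *)
Lemma dirichlet_const_incr k s b j : uniq (k :: s) -> (forall i, 0 < b i) ->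
  j \in k :: s ->
  ((b k + \sum_(i <- s) b i)%R%:E *
     dirichlet_const k s (fun i => b i + (i == j)%:R)%R =
   (b j)%:E * dirichlet_const k s b)%E.
Proof.
move=> + b0; elim: s => [|i s IH] /=.
  by rewrite inE big_nil addr0 => _ /eqP ->.
rewrite inE negb_or -!andbA => /and4P[ki ks si us].
have c0 : 0 < b k + \sum_(i <- s) b i.
  by rewrite ltr_wpDr// sumr_ge0// => ? _; exact: ltW.
rewrite big_cons !inE.
(* If [j] is the outermost coordinate, only the first argument of the outer beta integral
   changes. *)
have [-> _|ji] := eqVneq j i.
  rewrite (negbTE ki) addr0.
  rewrite (@eq_dirichlet_const k s _ b); last first.
    move=> h; have [->|hi _] := eqVneq h i.
      by rewrite inE eq_sym (negbTE ki) (negbTE si).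
    by rewrite /= mulr0n addr0.
  rewrite (_ : \sum_(h <- s) (b h + (h == i)%:R) = \sum_(h <- s) b h); last first.
    apply: eq_big_seq => h hs /=; have [hi|_] := eqVneq h i; last by rewrite mulr0n addr0.
    by rewrite hi (negbTE si) in hs.
  by rewrite addrCA muleCA beta_integral_incl// muleCA.
move=> /= jks.
have {}jks : j \in k :: s by rewrite inE.
rewrite addr0.
rewrite [X in beta_integral _ X](_ : _ = b k + \sum_(h <- s) b h + 1); last first.
  rewrite big_split/= addrACA; congr (_ + _).
  rewrite -(big_cons _ _ k s xpredT (fun h => (h == j)%:R)).
  rewrite (bigD1_seq j) ?cons_uniq ?ks//= eqxx big1_seq ?addr0//.
  by move=> h /andP[/negbTE ->].
(* Otherwise the second argument grows by 1; the factor this produces, the total over [k :: s], is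
   the one the induction hypothesis absorbs. *)
rewrite addrCA muleCA beta_integral_incr//.
rewrite muleA [X in (X * _)%E]muleC IH//; first by rewrite muleA.
by rewrite cons_uniq ks.
Qed.

(** Induction on the chart, innermost variable first. After each integration there remains a
    truncated power of the mass still to be distributed, [1 - \sum_j y j 0], times the powers of the
    coordinates already fixed. *)
Lemma iterated_integral_tpow k s b y : uniq (k :: s) ->
  {in k :: s, forall i, y i 0 = 0} ->
  iterated_integral s (fun x => (\prod_i tpow (b i)
    ((x + (1 - \sum_j x j 0) *: delta_mx k 0 : 'cV[R]_n) i 0))%:E) y =
  (dirichlet_const k s b *
   (tpow (b k + \sum_(i <- s) b i) (1 - \sum_j y j 0) *
    \prod_(i | i \notin k :: s) tpow (b i) (y i 0))%R%:E)%E.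
Proof.
elim: s y => [|i s IH] y /=.
  move=> _ y0; rewrite mul1e big_nil addr0 (bigD1 k)//= !mxE !eqxx mulr1.
  rewrite y0 ?inE// add0r; congr (_ * _)%:E; apply: eq_big => [i|i ik].
    by rewrite inE.
  by rewrite !mxE (negbTE ik) mulr0 addr0.
rewrite inE negb_or -!andbA => /and4P[ki ks si us] y0.
have yi : y i 0 = 0 by rewrite y0// !inE eqxx orbT.
under eq_integral => t _.
  rewrite IH/=; [|by rewrite ks|]; last first.
    move=> j jks; rewrite !mxE eqxx andbT.
    have -> : j == i = false.
      by apply/negP => /eqP ji; move: jks; rewrite ji inE eq_sym (negbTE ki) (negbTE si).
    rewrite mulr0 addr0 y0// !inE; move: jks.
    by rewrite inE => /orP[->//|->]; rewrite !orbT.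
  have -> : \sum_j (y + t *: delta_mx i 0) j 0 = \sum_j y j 0 + t.
    under eq_bigr do rewrite !mxE eqxx andbT.
    rewrite big_split/=; congr (_ + _).
    rewrite (bigD1 i)//= eqxx mulr1 big1 ?addr0// => j /negbTE ->.
    by rewrite mulr0.
  (* As [y i 0] is 0, the shifted vector has [t] at [i]. Isolating this factor exhibits the
     convolution in [t]. *)
  rewrite [\prod_(_ | _) _](bigD1 i)/=; last by rewrite inE eq_sym (negbTE ki) (negbTE si).
  rewrite !mxE !eqxx mulr1 yi add0r.
  rewrite [\prod_(_ | _) _](eq_bigr (fun j => tpow (b j) (y j 0))); last first.
    by move=> j /andP[_ /negbTE ji]; rewrite !mxE ji mulr0 addr0.
  rewrite opprD addrA mulrCA mulrA mulrC EFinM muleA.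
  over.
rewrite ge0_integralZl//; first last.
- rewrite mule_ge0 ?dirichlet_const_ge0// lee_fin prodr_ge0// => j _.
  exact: tpow_ge0.
- by move=> t _; rewrite lee_fin mulr_ge0// tpow_ge0.
- exact: measurable_tpow_conv.
rewrite integral_tpow_conv big_cons -!muleA; congr (_ * _)%E.
rewrite muleCA -EFinM; congr (_ * _%:E)%E.
rewrite mulrC (addrCA (b i)); congr (_ * _).
by apply: eq_bigl => j; rewrite !inE !negb_or -andbA (andbC (j \notin s)).
Qed.

Lemma dirichlet_kernel_tpow (a x : 'cV[R]_n) : (forall i, 0 < a i 0) ->
  dirichlet_kernel a x = \prod_i tpow (a i 0) (x i 0).
Proof.
move=> a0; rewrite /dirichlet_kernel; case: ifPn => [/forallP x0|].
  apply: eq_big => [i|i _]; first by rewrite a0.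
  by rewrite /tpow; have := x0 i; rewrite a0/= => ->.
rewrite negb_forall => /existsP[i]; rewrite a0/= => /negbTE xi.
by rewrite (bigD1 i)//= {1}/tpow xi mul0r.
Qed.

(** Meant for monomial weights [f], whose only effect on the kernel is to change its exponents from
    [a] to [b]. *)
Lemma dirichlet_integral_tpow (a : 'cV[R]_n) b (f : n.-tuple R -> \bar R) k s :
  enum 'I_n = k :: s -> (forall i, 0 < a i 0) ->
  (forall x : 'cV[R]_n, (f [tuple x i 0%R | i < n] *
     (\prod_i tpow (a i 0) (x i 0))%R%:E = (\prod_i tpow (b i) (x i 0))%R%:E)%E) ->
  dirichlet_integral a f = dirichlet_const k s b.
Proof.
move=> ks a0 fE; rewrite /dirichlet_integral.
have -> : [seq i <- enum 'I_n | 0 < a i 0] = k :: s.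
  by rewrite -ks; apply/all_filterP/allP => i _; exact: a0.
have uks : uniq (k :: s) by rewrite -ks enum_uniq.
transitivity (iterated_integral s (fun x => (\prod_i tpow (b i)
    ((x + (1 - \sum_j x j 0) *: delta_mx k 0 : 'cV[R]_n) i 0))%:E) 0).
  congr (iterated_integral _ _ _); apply/funext => y /=.
  by rewrite dirichlet_kernel_tpow// fE.
rewrite iterated_integral_tpow//; last by move=> i _; rewrite mxE.
have -> : \sum_j (0 : 'cV[R]_n) j 0 = 0 by rewrite big1// => j _; rewrite mxE.
rewrite subr0 tpow1 mul1r big1 ?mule1// => i.
by rewrite -ks mem_enum.
Qed.

End dirichlet_integral.

(** * Calculus of finite means *)

Section has_mean.
Context {d} {T : measurableType d} {R : realType} (P : probability T R).
Implicit Types (g h : T -> R) (u v c : R).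

(** Integrability travels with the value, so that linear combinations raise no further side
    conditions. *)
Definition has_mean g v : Prop :=
  P.-integrable [set: T] (EFin \o g) /\ (\int[P]_w (g w)%:E = v%:E)%E.

Lemma has_mean_fine g v : has_mean g v -> fine 'E_P[g] = v.
Proof. by move=> [_ gv]; rewrite unlock gv. Qed.

Lemma has_mean_cst c : has_mean (cst c) c.
Proof.
split; first exact: finite_measure_integrable_cst.
by have := expectation_cst P c; rewrite unlock.
Qed.

Lemma has_meanD g h u v : has_mean g u -> has_mean h v ->
  has_mean (fun w => g w + h w) (u + v).
Proof.
move=> [ig gu] [ih hv]; split; first exact: (integrableD _ ig ih).
under eq_integral do rewrite EFinD.
by rewrite integralD// gu hv.
Qed.

Lemma has_meanZ c g u : has_mean g u -> has_mean (fun w => c * g w) (c * u).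
Proof.
move=> [ig gu]; split; first exact: (integrableZl _ _ ig).
under eq_integral do rewrite EFinM.
by rewrite integralZl// gu.
Qed.

Lemma has_mean_sum (I : Type) (s : seq I) (g : I -> T -> R) (v : I -> R) :
  (forall i, has_mean (g i) (v i)) ->
  has_mean (fun w => \sum_(i <- s) g i w) (\sum_(i <- s) v i).
Proof.
move=> gv; elim: s => [|i s IH].
  rewrite big_nil; under eq_fun do rewrite big_nil.
  exact: has_mean_cst.
rewrite big_cons; under eq_fun do rewrite big_cons.
exact: has_meanD.
Qed.

(** Since [P] may be incomplete, measurability of [h] does not follow from almost sure equality and
    is assumed. *)
Lemma has_mean_ae g h v : has_mean g v -> measurable_fun [set: T] h ->
  {ae P, forall w, h w = g w} -> has_mean h v.
Proof.
move=> [ig gv] mh hg.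
have mg : measurable_fun [set: T] (EFin \o g) by exact: measurable_int ig.
have mh' : measurable_fun [set: T] (EFin \o h) by exact/measurable_EFinP.
have hgE : ae_eq P [set: T] (EFin \o g) (EFin \o h).
  by apply: filterS hg => w /= -> _.
split; last by rewrite -gv; apply/esym/ae_eq_integral.
apply/integrableP; split => //.
case/integrableP: ig => _; congr (_ < _)%E.
apply: ge0_ae_eq_integral => //; [exact: measurableT_comp..|].
by apply: filterS hgE => w /= + _ => /(_ I) [->].
Qed.

Lemma has_mean_ge0 g v : measurable_fun [set: T] g -> (forall w, 0 <= g w) ->
  (\int[P]_w (g w)%:E = v%:E)%E -> has_mean g v.
Proof.
move=> mg g0 gv; split=> //; apply/integrableP; split; first exact/measurable_EFinP.
under eq_integral do rewrite /= ger0_norm//.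
by rewrite gv ltry.
Qed.

Lemma integral_eq0_ae g : measurable_fun [set: T] g -> (forall w, 0 <= g w) ->
  (\int[P]_w (g w)%:E = 0)%E -> {ae P, forall w, g w = 0}.
Proof.
move=> mg g0 ig.
have : ae_eq P [set: T] (EFin \o g) (cst 0%E).
  apply/ae_eq_integral_abs => //; first exact/measurable_EFinP.
  by under eq_integral do rewrite /= ger0_norm//.
by apply: filterS => w /= /(_ I) [].
Qed.

End has_mean.

(** * Moments of Dirichlet vectors *)

Section dirichlet_moments.
Context {R : realType} {n : nat}.
Implicit Types (a : 'cV[R]_n) (l : seq 'I_n).

Lemma iterated_integral0 s (f : 'cV[R]_n -> \bar R) x :
  (forall y, f y = 0%E) -> iterated_integral s f x = 0%E.
Proof.
move=> f0; elim: s x => [|i s IH] x //=.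
by under eq_integral do rewrite IH; rewrite integral0.
Qed.

Lemma dirichlet_integral0 a (f : n.-tuple R -> \bar R) :
  (forall x : 'cV[R]_n,
    (f [tuple x i 0%R | i < n] * (dirichlet_kernel a x)%:E = 0)%E) ->
  dirichlet_integral a f = 0%E.
Proof.
move=> f0; rewrite /dirichlet_integral.
by case: [seq _ <- _ | _] => // k s; exact: iterated_integral0.
Qed.

(** The face is a single vertex, so the chart is empty and the integral is an evaluation. *)
Lemma dirichlet_integral_delta (i : 'I_n) (f : n.-tuple R -> \bar R) :
  dirichlet_integral (delta_mx i 0) f = f [tuple (j == i)%:R | j < n].
Proof.
rewrite /dirichlet_integral.
have -> : [seq j <- enum 'I_n | 0 < (delta_mx i 0 : 'cV[R]_n) j 0] = [:: i].
  rewrite -[RHS](@filter_pred1_uniq _ (enum 'I_n) i) ?enum_uniq ?mem_enum//.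
  by apply: eq_filter => j; rewrite mxE eqxx andbT ltr0n lt0b.
have s0 : \sum_j (0 : 'cV[R]_n) j 0 = 0 by rewrite big1// => j _; rewrite mxE.
rewrite /= s0 subr0 scale1r add0r /dirichlet_kernel ifT; last first.
  by apply/forallP => j; rewrite implybb.
rewrite big1 ?mule1; last first.
  move=> j; rewrite mxE eqxx andbT ltr0n lt0b => /eqP ->.
  by rewrite eqxx powR1.
by congr f; apply: eq_mktuple => j; rewrite mxE eqxx andbT.
Qed.

(** The probability of the draws [l] in a Polya urn with initial weights [a]: each factor is the
    chance of [j] after the draws [l']. *)
Fixpoint dirichlet_moment a l : R :=
  if l is j :: l' then
    (a j 0 + (count_mem j l')%:R) / (\sum_i a i 0 + (size l')%:R) *
    dirichlet_moment a l'
  else 1.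

Let shape a l i := a i 0 + (count_mem i l)%:R.

(** Positive parts make the monomial an admissible nonnegative test function for [is_dirichlet].
    Where a coordinate is not positive, its truncated power makes both sides vanish. *)
Let tpow_monomial a l (x : 'cV[R]_n) :
  (\prod_(j <- l) Num.max (x j 0) 0) * \prod_i tpow (a i 0) (x i 0) =
  \prod_i tpow (shape a l i) (x i 0).
Proof.
elim: l => [|j l IH].
  by rewrite big_nil mul1r; apply: eq_bigr => i _; rewrite /shape addr0.
rewrite big_cons -mulrA IH (bigD1 j)//= [RHS](bigD1 j)//= mulrA; congr (_ * _).
  rewrite /shape /= eqxx natrD addrCA addrC tpowS.
  have [x0|x0] := leP (x j 0) 0; last by [].
  by rewrite tpow_le0// !mulr0.
by apply: eq_bigr => i /negbTE ij; rewrite /shape /= eq_sym ij add0n.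
Qed.

Context {d} {T : measurableType d} {P : probability T R}.
Context (X : {RV P >-> n.-tuple R}).

Let measurable_coord i : measurable_fun [set: n.-tuple R] (fun x => tnth x i).
Proof. exact: measurable_tnth. Qed.

Lemma measurable_dirichlet_coord i : measurable_fun [set: T] (fun w => tnth (X w) i).
Proof. exact: (measurableT_comp (measurable_tnth i) (measurable_funPT X)). Qed.

(** Test the law against the negative part of the coordinate, which is 0 wherever the kernel is
    not. *)
Lemma dirichlet_coord_ge0 a i : is_dirichlet X a -> (forall i, 0 < a i 0) ->
  {ae P, forall w, 0 <= tnth (X w) i}.
Proof.
move=> [_ _ XE] a0.
have mf : measurable_fun [set: n.-tuple R] (fun x => Num.max (- tnth x i) 0).
  by apply: measurable_maxr => //; apply: measurableT_comp.
have : {ae P, forall w, Num.max (- tnth (X w) i) 0 = 0}.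
  apply: integral_eq0_ae.
  - exact: (measurableT_comp mf (measurable_funPT X)).
  - by move=> w; rewrite le_max lexx orbT.
  rewrite (XE (fun x => (Num.max (- tnth x i) 0)%:E)).
  - rewrite [X in (_ * X)%E]dirichlet_integral0 ?mule0// => x.
    rewrite tnth_mktuple dirichlet_kernel_tpow//.
    have [x0|x0] := leP (x i 0) 0.
      by rewrite (bigD1 i)//= tpow_le0// mul0r mule0.
    by rewrite max_r ?mul0e// oppr_le0 ltW.
  - exact/measurable_EFinP.
  - by move=> x; rewrite lee_fin le_max lexx orbT.
apply: filterS => w /eqP.
by rewrite eq_maxr oppr_le0.
Qed.

(** Test the law against the distance of the coordinate to its value at the vertex. *)
Lemma dirichlet_delta_coord k i : is_dirichlet X (delta_mx k 0) ->
  {ae P, forall w, tnth (X w) i = (i == k)%:R}.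
Proof.
move=> [_ _ XE].
have mf : measurable_fun [set: n.-tuple R] (fun x => `|tnth x i - (i == k)%:R|).
  by apply: measurableT_comp => //; exact: measurable_funB.
have : {ae P, forall w, `|tnth (X w) i - (i == k)%:R| = 0}.
  apply: integral_eq0_ae => //.
  - exact: (measurableT_comp mf (measurable_funPT X)).
  rewrite (XE (fun x => `|tnth x i - (i == k)%:R|%:E)).
  - by rewrite [X in (_ * X)%E]dirichlet_integral_delta tnth_mktuple subrr normr0 mule0.
  - exact/measurable_EFinP.
  - by move=> x; rewrite lee_fin.
by apply: filterS => w /eqP; rewrite normr_eq0 subr_eq0 => /eqP.
Qed.

Lemma has_mean_dirichlet a l : is_dirichlet X a -> (forall i, 0 < a i 0) ->
  has_mean P (fun w => \prod_(j <- l) tnth (X w) j) (dirichlet_moment a l).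
Proof.
move=> Xa a0; have [_ [i0 _] XE] := Xa.
have mpos l' : measurable_fun [set: n.-tuple R]
    (fun x => \prod_(j <- l') Num.max (tnth x j) 0).
  by apply: measurable_prod => j _; apply: measurable_maxr.
(* Almost surely the coordinates equal their positive parts, whose products are nonnegative test
   functions. *)
apply: (@has_mean_ae _ _ _ _ (fun w => \prod_(j <- l) Num.max (tnth (X w) j) 0));
  last 2 first.
- by apply: measurable_prod => j _; exact: measurable_dirichlet_coord.
- have : {ae P, forall w, forall i, 0 <= tnth (X w) i}.
    exact: filter_forall (fun i => dirichlet_coord_ge0 i Xa a0).
  apply: filterS => w Xw; apply: eq_bigr => j _.
  by rewrite max_l.
apply: has_mean_ge0.
- exact: (measurableT_comp (mpos l) (measurable_funPT X)).
- by move=> w; apply: prodr_ge0 => j _; rewrite le_max lexx orbT.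
have [k [s ks]] : exists k s, enum 'I_n = k :: s.
  case: (enum 'I_n) (mem_enum 'I_n i0) => // k s _; by exists k, s.
have JE l' : dirichlet_integral a
    (fun x => (\prod_(j <- l') Num.max (tnth x j) 0)%:E) =
    dirichlet_const k s (shape a l').
  apply: dirichlet_integral_tpow => // x.
  rewrite -EFinM -tpow_monomial; congr (_ * _)%:E.
  by apply: eq_bigr => j _; rewrite tnth_mktuple.
have IE l' : (\int[P]_w (\prod_(j <- l') Num.max (tnth (X w) j) 0)%:E =
    ((fine (dirichlet_integral a (cst 1%E)))^-1)%:E *
    dirichlet_const k s (shape a l'))%E.
  rewrite (XE (fun x => (\prod_(j <- l') Num.max (tnth x j) 0)%:E)) ?JE//.
    exact/measurable_EFinP.
  by move=> x; rewrite lee_fin prodr_ge0// => j _; rewrite le_max lexx orbT.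
(* The empty monomial fixes the normalization: [P] has mass 1, so the inverse constant times the
   Dirichlet constant is 1. Each further index brings one use of the recurrence. *)
rewrite IE; elim: l => [|j l IH].
  rewrite -IE; under eq_integral do rewrite big_nil.
  by have := expectation_cst P 1; rewrite unlock.
set B := (_^-1)%:E in IH *.
have s0 i : 0 < shape a l i by rewrite ltr_wpDr.
(* The multiplicities in [l] add up to its length, which yields the denominator of
   [dirichlet_moment]. *)
have sumE : shape a l k + \sum_(i <- s) shape a l i = \sum_i a i 0 + (size l)%:R.
  rewrite -(big_cons _ _ k s xpredT (shape a l)) -ks big_enum/=.
  rewrite big_split/=; congr (_ + _).
  elim: (l) => [|h l' IHl]; first by rewrite big1.
  rewrite /= -add1n natrD -IHl -[1%:R](_ : \sum_i (h == i)%:R = 1%:R).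
    by rewrite -big_split/=; apply: eq_bigr => i _; rewrite natrD.
  by rewrite (bigD1 h)//= eqxx big1 ?addr0// => i /negbTE; rewrite eq_sym => ->.
have sum0 : 0 < \sum_i a i 0 + (size l)%:R.
  by rewrite -sumE ltr_wpDr// sumr_ge0// => i _; exact: ltW.
have := @dirichlet_const_incr R n k s (shape a l) j.
rewrite -ks enum_uniq mem_enum sumE => /(_ isT s0 isT) incr.
rewrite (@eq_dirichlet_const _ _ k s (shape a (j :: l))
  (fun i => shape a l i + (i == j)%:R)); last first.
  by move=> i _; rewrite /shape /= natrD eq_sym addrAC addrA.
have S0 : \sum_i a i 0 + (size l)%:R != 0 by rewrite gt_eqF.
rewrite /= -mulrA mulrCA EFinM; apply/esym/eqP.
by rewrite eqe_pdivrMl// muleCA incr muleCA IH EFinM.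
Qed.

End dirichlet_moments.

(** * Entrywise bounds for the matrix norm *)

Section matrix_norm.
Context {R : realType} {m n : nat}.
Implicit Types M : 'M[R]_(m, n).

Lemma coord_le_mx_norm M i j : `|M i j| <= `|M|.
Proof.
rewrite [leRHS]/Num.norm/= mx_normrE.
exact: (le_bigmax 0 (fun ij : 'I_m * 'I_n => `|M ij.1 ij.2|) (i, j)).
Qed.

Lemma mx_norm_le M (B : R) : 0 <= B -> (forall i j, `|M i j| <= B) -> `|M| <= B.
Proof.
move=> B0 MB; rewrite [leLHS]/Num.norm/= mx_normrE.
by apply: bigmax_le => // -[i j] _; exact: MB.
Qed.

End matrix_norm.

(** * Centered moments of a symmetric Dirichlet vector *)

Section symmetric_dirichlet.
Context {R : realType} {n : nat} {d} {T : measurableType d}.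
Context {P : probability T R} {X : {RV P >-> n.-tuple R}} {alpha : R}.
Context (n0 : (0 < n)%N) (alpha0 : 0 < alpha).
Context (Xalpha : is_dirichlet X (const_mx alpha)).
Implicit Types i j k : 'I_n.

Let A : R := n%:R * alpha.
Let Y i w : R := tnth (X w) i - n%:R^-1.
Let nR : (0 : R) < n%:R. Proof. by rewrite ltr0n. Qed.
Let nN0 : (n%:R : R) != 0. Proof. by rewrite gt_eqF. Qed.
Let A0 : 0 < A. Proof. by rewrite mulr_gt0. Qed.
Let alphaN0 : alpha != 0. Proof. by rewrite gt_eqF. Qed.
Let A1N0 : n%:R * alpha + 1 != 0. Proof. by rewrite gt_eqF// addr_gt0. Qed.
Let A2N0 : n%:R * alpha + 2 != 0. Proof. by rewrite gt_eqF// addr_gt0. Qed.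

Let sum_alpha : \sum_i (const_mx alpha : 'cV[R]_n) i 0 = n%:R * alpha.
Proof.
by under eq_bigr do rewrite mxE; rewrite sumr_const card_ord mulr_natl.
Qed.

Let moment l : has_mean P (fun w => \prod_(j <- l) tnth (X w) j)
  (dirichlet_moment (const_mx alpha) l).
Proof. by apply: has_mean_dirichlet => // i; rewrite mxE. Qed.

Let has_mean_eq g h u v : has_mean P g u -> g =1 h -> u = v -> has_mean P h v.
Proof. by move=> gu /funext <- <-. Qed.

Let mean1 i : has_mean P (fun w => tnth (X w) i) n%:R^-1.
Proof.
apply: (has_mean_eq (moment [:: i])) => [w|]; first by rewrite big_seq1.
by rewrite /= mxE sum_alpha; field; rewrite nN0 alphaN0.
Qed.

Let mean2 i j : has_mean P (fun w => tnth (X w) i * tnth (X w) j)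
  ((alpha + (i == j)%:R) / (n%:R * (A + 1))).
Proof.
apply: (has_mean_eq (moment [:: i; j])) => [w|]; first by rewrite big_cons big_seq1.
by rewrite /= !mxE sum_alpha addn0 eq_sym /A; field; rewrite ?nN0 ?alphaN0 ?A1N0 ?A2N0.
Qed.

Let mean3 i j k :
  has_mean P (fun w => tnth (X w) i * tnth (X w) j * tnth (X w) k)
  ((alpha + (i == j)%:R + (i == k)%:R) * (alpha + (j == k)%:R) /
   (n%:R * (A + 1) * (A + 2))).
Proof.
apply: (has_mean_eq (moment [:: i; j; k])) => [w|].
  by rewrite !big_cons big_nil mulr1 mulrA.
rewrite /= !mxE sum_alpha !addn0 natrD (eq_sym j) (eq_sym k) (eq_sym k j) /A.
by field; rewrite ?nN0 ?alphaN0 ?A1N0 ?A2N0.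
Qed.

Lemma symmetric_dirichlet_mean i : has_mean P (Y i) 0.
Proof.
apply: (has_mean_eq (has_meanD (mean1 i) (has_mean_cst P (- n%:R^-1)))) => //.
by rewrite subrr.
Qed.

Lemma symmetric_dirichlet_cov i j : has_mean P (fun w => Y i w * Y j w)
  ((n%:R * (i == j)%:R - 1) / (n%:R ^+ 2 * (A + 1))).
Proof.
have H := has_meanD (has_meanD (has_meanD (mean2 i j)
  (has_meanZ (- n%:R^-1) (mean1 i))) (has_meanZ (- n%:R^-1) (mean1 j)))
  (has_mean_cst P (n%:R^-1 ^+ 2)).
apply: (has_mean_eq H) => [w|]; first by rewrite /Y /cst; ring.
by rewrite /A; field; rewrite ?nN0 ?alphaN0 ?A1N0 ?A2N0.
Qed.

Lemma symmetric_dirichlet_third i j k :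
  has_mean P (fun w => Y i w * Y j w * Y k w)
  ((2 * n%:R ^+ 2 * ((i == k)%:R * (j == k)%:R)
    - 2 * n%:R * ((i == j)%:R + (i == k)%:R + (j == k)%:R) + 4) /
   (n%:R ^+ 3 * (A + 1) * (A + 2))).
Proof.
have H := has_meanD (has_meanD (has_meanD (has_meanD (has_meanD (has_meanD (has_meanD
  (mean3 i j k)
  (has_meanZ (- n%:R^-1) (mean2 i j))) (has_meanZ (- n%:R^-1) (mean2 i k)))
  (has_meanZ (- n%:R^-1) (mean2 j k)))
  (has_meanZ (n%:R^-1 ^+ 2) (mean1 i))) (has_meanZ (n%:R^-1 ^+ 2) (mean1 j)))
  (has_meanZ (n%:R^-1 ^+ 2) (mean1 k))) (has_mean_cst P (- n%:R^-1 ^+ 3)).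
apply: (has_mean_eq H) => [w|]; first by rewrite /Y /cst; ring.
(* A product of two of these indicators is the indicator of [i = j = k]. This relation must be
   supplied by hand, as [field] sees the indicators as free variables. *)
have eqM : (i == j)%:R * (j == k)%:R = (i == k)%:R * (j == k)%:R :> R.
  by have [->|_] := eqVneq j k; rewrite ?mulr0.
have eqM' : (i == k)%:R * (j == k)%:R = (i == k)%:R * (i == j)%:R :> R.
  by have [->|_] := eqVneq i k; rewrite ?mul0r// eq_sym.
move: eqM eqM'.
move: (i == j)%:R (j == k)%:R (i == k)%:R => x y z eqM eqM'.
rewrite /A.
transitivity ((alpha ^+ 2 + alpha * (x + y + z) + 2 * (z * y)) /
    (n%:R * (n%:R * alpha + 1) * (n%:R * alpha + 2))
  - (3 * alpha + x + y + z) / (n%:R ^+ 2 * (n%:R * alpha + 1)) + 2 * n%:R^-1 ^+ 3).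
  rewrite (_ : (alpha + x + z) * (alpha + y) =
    alpha ^+ 2 + alpha * (x + y + z) + 2 * (z * y)).
    by field; rewrite ?nN0 ?alphaN0 ?A1N0 ?A2N0.
  have -> : (alpha + x + z) * (alpha + y) =
    alpha ^+ 2 + alpha * (x + y + z) + (x * y + z * y) by ring.
  by rewrite eqM; ring.
by field; rewrite ?nN0 ?alphaN0 ?A1N0 ?A2N0.
Qed.

End symmetric_dirichlet.

(** * Contraction of the third moments with the Hessian *)

Section quadratic_third_moment.
Context {R : realType} {n : nat}.
Context (H : 'M[R]_n).

(* The first summand on the right does not depend on [k]: it goes into epsilon_0. *)
Lemma sum_third_moment (k : 'I_n) (q : R) :
  \sum_i \sum_j H i j * ((2 * n%:R ^+ 2 * ((i == k)%:R * (j == k)%:R)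
    - 2 * n%:R * ((i == j)%:R + (i == k)%:R + (j == k)%:R) + 4) / q) =
  2 / q * (2 * \sum_i \sum_j H i j - n%:R * \sum_i H i i) +
  2 / q * (n%:R ^+ 2 * H k k - n%:R * (\sum_i (H k i + H i k))).
Proof.
have sum1 (F : 'I_n -> R) h : \sum_i F i * (i == h)%:R = F h.
  rewrite (bigD1 h)//= eqxx mulr1 big1 ?addr0// => i /negbTE ->.
  by rewrite mulr0.
have E i : \sum_j H i j * ((2 * n%:R ^+ 2 * ((i == k)%:R * (j == k)%:R)
    - 2 * n%:R * ((i == j)%:R + (i == k)%:R + (j == k)%:R) + 4) / q) =
    2 / q * (n%:R ^+ 2 * (H i k * (i == k)%:R) - n%:R * H i i
      - n%:R * ((\sum_j H i j) * (i == k)%:R) - n%:R * H i k + 2 * \sum_j H i j).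
  rewrite (eq_bigr (fun j => 2 / q * (n%:R ^+ 2 * (i == k)%:R * (H i j * (j == k)%:R)
    - n%:R * (H i j * (j == i)%:R) - n%:R * (i == k)%:R * H i j
    - n%:R * (H i j * (j == k)%:R) + 2 * H i j))).
    by rewrite -mulr_sumr !big_split/= !sumrN -!mulr_sumr !sum1; ring.
  by move=> j _; rewrite (eq_sym i j); ring.
rewrite (eq_bigr _ (fun i _ => E i)) -mulr_sumr !big_split/= !sumrN -!mulr_sumr.
by rewrite (sum1 (H ^~ k)) (sum1 (fun i => \sum_j H i j)); ring.
Qed.

(** The diagonal entry contributes [n^2 |H|]; the row and the column of [k] have [2 n] entries in
    all, hence contribute at most [2 n^2 |H|]. *)
Lemma third_moment_bound (k : 'I_n) :
  `|n%:R ^+ 2 * H k k - n%:R * (\sum_i (H k i + H i k))| <= 3 * n%:R ^+ 2 * `|H|.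
Proof.
have sumH : `|\sum_i (H k i + H i k)| <= n%:R * (2 * `|H|).
  apply: (le_trans (ler_norm_sum _ _ _)).
  have -> : n%:R * (2 * `|H|) = \sum_(i < n) (2 * `|H|).
    by rewrite sumr_const card_ord mulr_natl.
  apply: ler_sum => i _.
  apply: (le_trans (ler_normD _ _)); rewrite mulr2n mulrDl mul1r.
  by apply: lerD; exact: coord_le_mx_norm.
apply: (le_trans (ler_normB _ _)); rewrite !normrM !normr_nat.
rewrite (_ : 3 * _ * _ = n%:R * n%:R * `|H| + n%:R * (n%:R * (2 * `|H|))); last by ring.
by rewrite lerD// ler_wpM2l ?mulr_ge0// coord_le_mx_norm.
Qed.

End quadratic_third_moment.

(** * The mixture as an affine image of its symmetric component *)

Section mixture.
Context {R : realType} {n : nat} {d} {T : measurableType d} {P : probability T R}.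
Context (i1 : 'I_n) (p : 'cV[R]_n) (delta : 'I_n -> {RV P >-> n.-tuple R}).

(** The components other than [i1] are almost surely vertices, and their weighted sum has [i]-th
    coordinate [p i 0 - p i1 0]. Subtracting [p] leaves [- p i1 0], which centers the symmetric
    component at [1 / n]. *)
Lemma mixture_centered :
  (forall l, l != i1 -> is_dirichlet (delta l) (delta_mx l 0)) ->
  {ae P, forall w, forall i, (mixture i1 p delta w - p) i 0 =
    n%:R * p i1 0 * (tnth (delta i1 w) i - n%:R^-1)}.
Proof.
move=> deltaE.
have nN0 : (n%:R : R) != 0 by rewrite pnatr_eq0 -lt0n (leq_ltn_trans _ (ltn_ord i1)).
have : {ae P, forall w, forall li : 'I_n * 'I_n, li.1 != i1 ->
    tnth (delta li.1 w) li.2 = (li.2 == li.1)%:R}.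
  apply: filter_forall => -[l i] /=.
  have [->|li1] := eqVneq l i1; first exact: aeW.
  by apply: filterS (dirichlet_delta_coord i (deltaE _ li1)) => w.
apply: filterS => w dw i.
rewrite /mixture !mxE summxE (bigD1 i1)//= !mxE /theta eqxx.
rewrite (eq_bigr (fun l => (p l 0 - p i1 0) * (l == i)%:R)); last first.
  by move=> l li1; rewrite !mxE (negbTE li1) (dw (l, i) li1) /= eq_sym.
have -> : \sum_(l | l != i1) (p l 0 - p i1 0) * (l == i)%:R = p i 0 - p i1 0.
  (* The missing index [i1] can be added, as its weight here is 0. *)
  transitivity (\sum_l (p l 0 - p i1 0) * (l == i)%:R).
    by rewrite [RHS](bigD1 i1)//= subrr mul0r add0r.
  rewrite (bigD1 i)//= eqxx mulr1 big1 ?addr0// => l /negbTE ->.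
  by rewrite mulr0.
by field.
Qed.

Lemma measurable_mixture i :
  measurable_fun [set: T] (fun w => (mixture i1 p delta w - p) i 0).
Proof.
under eq_fun do rewrite /mixture !mxE summxE.
apply: measurable_funB => //; apply: measurable_sum => l.
under eq_fun do rewrite !mxE.
by apply: measurable_funM => //; exact: measurable_dirichlet_coord.
Qed.

End mixture.

(** * Moment conditions and error bound for the mixture *)

Theorem theorem6 (R : realType) :
  exists C : R,
  forall (n : nat) (i1 : 'I_n) (p : 'cV[R]_n) (eta : R)
    (d : measure_display) (Omega : measurableType d)
    (P : probability Omega R) (delta : 'I_n -> {RV P >-> n.-tuple R}),
  (2 <= n)%N ->
  nat_of_ord i1 = 0%N ->
  simplex p ->
  0 < p i1 0 ->
  (forall i j : 'I_n, (i <= j)%N -> p i 0 <= p j 0) ->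
  mutually_independent delta ->
  is_dirichlet (delta i1) (const_mx (n%:R `^ eta)) ->
  (forall l : 'I_n, l != i1 -> is_dirichlet (delta l) (delta_mx l 0)) ->
  let D : Omega -> 'cV[R]_n := mixture i1 p delta in
  let S : 'cV[R]_n -> 'cV[R]_n := fun x => gamma_coef i1 p eta *: (x - p) in
  [/\ expectation_mx P (fun w => S (D w)) = 0,
      exists lambda : R,
        expectation_mx P (fun w => (D w - p) *m (S (D w))^T) =
        1%:M - lambda *: (const_mx 1 *m (const_mx 1 : 'cV[R]_n)^T) &
      forall (Z : 'cV[R]_n -> R) (c : R),
        class_C 2 Z -> 0 < c ->
        exists epsilon0 : R,
          `| (c / 2) *: expectation_mx P (fun w =>
               ((D w - p)^T *m hessian Z p *m (D w - p)) 0 0 *: S (D w))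
             - epsilon0 *: (const_mx 1 : 'cV[R]_n) |
          <= C * (c * `| hessian Z p | * n%:R `^ (- eta - 1)) ].
Proof.
exists 3 => n i1 p eta d Omega P delta n2 i10 [p0 psum] p1 pmono _ Ddir Ddelta D S.
have n0 : (0 < n)%N by exact: leq_trans n2.
have nR : (0 : R) < n%:R by rewrite ltr0n.
have nN0 : (n%:R : R) != 0 by rewrite gt_eqF.
have p1N0 : p i1 0 != 0 by rewrite gt_eqF.
set alpha := n%:R `^ eta in Ddir.
have alpha0 : 0 < alpha by exact: powR_gt0.
have A0 : 0 < n%:R * alpha by rewrite mulr_gt0.
have A1N0 : n%:R * alpha + 1 != 0 by rewrite gt_eqF// addr_gt0.
have A2N0 : n%:R * alpha + 2 != 0 by rewrite gt_eqF// addr_gt0.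
have AE : n%:R `^ (eta + 1) = n%:R * alpha.
  by rewrite powRD ?nN0 ?implybT// powRr1 ?ltW// mulrC.
have AVE : n%:R `^ (- eta - 1) = (n%:R * alpha)^-1.
  by rewrite -opprD powRN AE.
have gE : gamma_coef i1 p eta = (n%:R * alpha + 1) / (n%:R * p i1 0 ^+ 2).
  by rewrite /gamma_coef AE.
(* The smallest coordinate is at most the average [1 / n]. *)
have np1 : n%:R * p i1 0 <= 1.
  have -> : n%:R * p i1 0 = \sum_(i < n) p i1 0.
    by rewrite sumr_const card_ord mulr_natl.
  rewrite -psum; apply: ler_sum => i _.
  by apply: pmono; rewrite i10.
set kappa := n%:R * p i1 0.
set Y := fun i w => tnth (delta i1 w) i - (n%:R^-1 : R).
have DY : {ae P, forall w, forall i, (D w - p) i 0 = kappa * Y i w}.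
  exact: mixture_centered Ddelta.
have mD i : measurable_fun [set: Omega] (fun w => (D w - p) i 0).
  exact: measurable_mixture.
have mS i : measurable_fun [set: Omega] (fun w => S (D w) i 0).
  by under eq_fun do rewrite mxE; exact: measurable_funM.
split.
- apply/matrixP => i j; rewrite !mxE ord1; apply: (@has_mean_fine _ _ _ P).
  have H := has_meanZ (gamma_coef i1 p eta * kappa) (symmetric_dirichlet_mean n0 alpha0 Ddir i).
  rewrite mulr0 in H; apply: (has_mean_ae H) => //.
  by apply: filterS DY => w Dw; rewrite mxE Dw /Y; ring.
(* Here [gamma * kappa^2 = n (A + 1)] with [A = n * alpha], which turns the covariance into [[i = j]
   - 1 / n]; hence [lambda = 1 / n]. *)
- exists n%:R^-1; apply/matrixP => i j.
  rewrite !mxE big_ord1 !mxE !mulr1; apply: (@has_mean_fine _ _ _ P).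
  have H := has_meanZ (gamma_coef i1 p eta * kappa ^+ 2)
    (symmetric_dirichlet_cov n0 alpha0 Ddir i j).
  rewrite (_ : _ - _ = gamma_coef i1 p eta * kappa ^+ 2 *
    ((n%:R * (i == j)%:R - 1) / (n%:R ^+ 2 * (n%:R * alpha + 1)))); last first.
    by rewrite gE /kappa; field; rewrite nN0 A1N0 p1N0.
  have DSE w : ((D w - p) *m (S (D w))^T) i j = (D w - p) i 0 * S (D w) j 0.
    by rewrite mxE big_ord1 [(_^T) _ _]mxE.
  under eq_fun do rewrite DSE.
  apply: (has_mean_ae H) => //; first exact: measurable_funM.
  by apply: filterS DY => w Dw; rewrite Dw [S _ _ _]mxE Dw /Y; ring.
move=> Z c _ c0; set H := hessian Z p.
set g := gamma_coef i1 p eta in gE *.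
set q := n%:R ^+ 3 * (n%:R * alpha + 1) * (n%:R * alpha + 2).
(* All prefactors together: [kappa] comes once from each of the three centered factors, and [2 / q]
   from the contracted third moment. *)
set K := c / 2 * g * kappa ^+ 3 * (2 / q).
have KE : K = c * p i1 0 / (n%:R * (n%:R * alpha + 2)).
  by rewrite /K gE /kappa /q; field; rewrite nN0 A1N0 A2N0 p1N0.
(* The part of the contracted moment that is common to all coordinates [k]. *)
exists (K * (2 * \sum_i \sum_j H i j - n%:R * \sum_i H i i)).
apply: mx_norm_le => [|k o].
  by rewrite !mulr_ge0 ?powR_ge0// ltW.
rewrite (ord1 o) !mxE mulr1.
have QE w : (((D w - p)^T *m H *m (D w - p)) 0 0 *: S (D w)) k 0 =
    \sum_i \sum_j H i j * ((D w - p) i 0 * (D w - p) j 0 * S (D w) k 0).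
  rewrite mxE mxE mulr_suml exchange_big/=; apply: eq_bigr => j _.
  rewrite mxE !mulr_suml; apply: eq_bigr => i _.
  rewrite [(_^T) _ _]mxE; ring.
have HQ := has_meanZ (g * kappa ^+ 3) (has_mean_sum (index_enum 'I_n)
  (fun i => has_mean_sum (index_enum 'I_n) (fun j => has_meanZ (H i j)
     (symmetric_dirichlet_third n0 alpha0 Ddir i j k)))).
rewrite -/q sum_third_moment in HQ.
rewrite (has_mean_fine (v := g * kappa ^+ 3 * _) (has_mean_ae HQ _ _)); last 2 first.
- under eq_fun do rewrite QE.
  apply: measurable_sum => i; apply: measurable_sum => j.
  by do 3!apply: measurable_funM => //.
- apply: filterS DY => w Dw; rewrite QE mulr_sumr; apply: eq_bigr => i _.
  rewrite mulr_sumr; apply: eq_bigr => j _.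
  by rewrite [S _ _ _]mxE -/g !Dw /Y; ring.
rewrite (_ : _ - _ = K * (n%:R ^+ 2 * H k k - n%:R * (\sum_i (H k i + H i k)))); last first.
  by rewrite /K; ring.
have K0 : 0 <= K.
  by rewrite KE divr_ge0 ?mulr_ge0 ?addr_ge0// ltW.
rewrite normrM (ger0_norm K0); apply: (le_trans (ler_wpM2l K0 (third_moment_bound H k))).
rewrite AVE KE.
(* The last factor is at most [1 / A], by [n p_1 <= 1] and [A <= A + 2], and [1 / A] is the required
   power of [n]. *)
rewrite (_ : _ * (3 * _ * _) = 3 * (c * `|H|) * (n%:R * p i1 0 / (n%:R * alpha + 2))); last first.
  by field; rewrite nN0 A2N0.
rewrite [leRHS]mulrA ler_wpM2l//; first by rewrite mulr_ge0// mulr_ge0// ltW.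
rewrite ler_pdivrMr ?addr_gt0// (le_trans np1)// ler_pdivlMl//.
by rewrite mulr1 lerDl.
Qed.
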